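(* Let $y\in U$, $x\in C$, and $\lambda\ge1$. Then $$x\in\overleftarrow{Q}_C(y)\quad\Longleftrightarrow\quad(\forall c\in C)\;\; D(c,x)\le\langle\nabla f(y)-\nabla f(x),c-x\rangle.$$ If $x\in\overleftarrow{Q}_C(y)$ and $$z_\lambda:=\nabla f^*\big(\lambda\nabla f(y)+(1-\lambda)\nabla f(x)\big),$$ then $x\in\overleftarrow{Q}_C(z_\lambda)$; moreover, if $\lambda>1$, then $\overleftarrow{Q}_C(z_\lambda)=\{x\}$.
   Context: $\mathbb{R}^J$ is the standard Euclidean space with inner product $\langle\cdot,\cdot\rangle$ and norm $\|\cdot\|$. Standing assumptions: (1) $f\colon\mathbb{R}^J\to\,]-\infty,+\infty]$ is a convex function of Legendre type, i.e., $f$ is proper, lower semicontinuous, convex, essentially smooth (with $U:=\operatorname{int}\operatorname{dom} f\neq\varnothing$, $f$ is differentiable on $U$ and $\|\nabla f(x_n)\|\to+\infty$ whenever $(x_n)$ is a sequence in $U$ converging to a boundary point of $U$) and essentially strictly convex ($f$ is strictly convex on every convex subset of $\operatorname{dom}\partial f$). (2) $f$ is $1$-coercive: $\lim_{\|x\|\to+\infty} f(x)/\|x\|=+\infty$ (equivalently, $\operatorname{dom} f^*=\mathbb{R}^J$). (3) $C$ is a nonempty bounded closed (hence compact) subset of $U$. Here $f^*$ is the Fenchel conjugate; under these assumptions $\nabla f\colon U\to\mathbb{R}^J$ and $\nabla f^*\colon\mathbb{R}^J\to U$ are continuous bijections, inverse to each other. The Bregman distance is $D(x,y)=f(x)-f(y)-\langle\nabla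 f(y),x-y\rangle$ if $y\in U$, and $D(x,y)=+\infty$ otherwise. For $y\in U$, $\overleftarrow{Q}_C(y)=\operatorname{argmax}_{x\in C}D(x,y)$ (set of maximizers). *)

(* Defs.v *)
From HB Require Import structures.
From mathcomp Require Import all_boot all_order all_algebra.
From mathcomp Require Import all_classical all_reals all_analysis.

Set Implicit Arguments.
Unset Strict Implicit.
Unset Printing Implicit Defensive.

Import Order.TTheory GRing.Theory Num.Theory.
Import numFieldNormedType.Exports.

Local Open Scope classical_set_scope.
Local Open Scope ring_scope.
Local Open Scope ereal_scope.

(* R^J is 'rV[R]_J. Its library norm `|x| is the sup norm, so
   the Euclidean norm is defined here; the topology and differentiability are
   the library's, which do not depend on the choice of norm. *)

Section Euclidean.
Context {R : realType} {J : nat}.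
Implicit Types u v : 'rV[R]_J.

Definition dot u v : R := (\sum_(i < J) u 0 i * v 0 i)%R.

Definition enorm u : R := Num.sqrt (dot u u).

Definition ebounded (A : set 'rV[R]_J) : Prop :=
  exists M : R, forall x, A x -> (enorm x <= M)%R.

End Euclidean.

Section ConvexFunctions.
Context {R : realType} {J : nat}.
Implicit Types (f : 'rV[R]_J -> \bar R) (x y u : 'rV[R]_J).

Definition dom f : set 'rV[R]_J := [set x | f x < +oo].

Definition intdom f : set 'rV[R]_J := (dom f)°.

(* The first conjunct says that f takes its values in ]-oo, +oo]. *)
Definition proper f : Prop := (forall x, -oo < f x) /\ dom f !=set0.

(* The values are never -oo in use, and with 0 < t < 1 the products below are
   the usual ones, so no indeterminate form occurs. *)
Definition convex_efun f : Prop :=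
  forall x y (t : R), (0 < t < 1)%R ->
    f (t *: x + (1 - t) *: y)%R <= t%:E * f x + (1 - t)%:E * f y.

Definition subdiff f x : set 'rV[R]_J :=
  [set u | forall y, f x + (dot u (y - x))%:E <= f y].

Definition dom_subdiff f : set 'rV[R]_J := [set x | subdiff f x !=set0].

Definition strictly_convex_on f (S : set 'rV[R]_J) : Prop :=
  forall x y (t : R), S x -> S y -> x != y -> (0 < t < 1)%R ->
    f (t *: x + (1 - t) *: y)%R < t%:E * f x + (1 - t)%:E * f y.

(* Meaningful at points near which f is finite and at which it is
   differentiable; there [fine \o f] is f read as a real function. *)
Definition grad f x : 'rV[R]_J :=
  (\row_(i < J) 'D_(delta_mx 0 i) (fine \o f : 'rV[R]_J -> R) x)%R.

Definition essentially_smooth f : Prop :=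
  [/\ intdom f !=set0,
      forall x, intdom f x -> differentiable (fine \o f : 'rV[R]_J -> R) x
    & forall (x_ : nat -> 'rV[R]_J) (b : 'rV[R]_J),
        (forall n, intdom f (x_ n)) ->
        (closure (intdom f) `\` (intdom f)°) b ->
        x_ n @[n --> \oo] --> b ->
        enorm (grad f (x_ n)) @[n --> \oo] --> +oo%R].

Definition essentially_strictly_convex f : Prop :=
  forall S : set (convex_lmodType 'rV[R]_J),
    convex_set S -> S `<=` dom_subdiff f -> strictly_convex_on f S.

Definition legendre f : Prop :=
  [/\ proper f, lower_semicontinuous f, convex_efun f,
      essentially_smooth f & essentially_strictly_convex f].

Definition one_coercive f : Prop :=
  forall M : R, exists r : R, forall x, (r < enorm x)%R ->
    M%:E <= f x * ((enorm x)^-1)%:E.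

Definition fenchel_conj f u : \bar R :=
  ereal_sup (range (fun x => (dot u x)%:E - f x)).

Definition bregman f x y : \bar R :=
  if y \in intdom f then f x - f y - (dot (grad f y) (x - y))%:E else +oo.

(* argmax_(x in C) (bregman f x y), a map whose domain is int dom f: the
   condition [intdom f y] prevents membership from holding vacuously at points
   y where bregman f _ y is constantly +oo. *)
Definition farthest f (C : set 'rV[R]_J) y : set 'rV[R]_J :=
  [set x | [/\ intdom f y, C x & forall c, C c -> bregman f c y <= bregman f x y]].

End ConvexFunctions.

(* Main.v *)
(* Expanding Bregman distances turns membership of x in the farthest set of u
   into D(c,x) <= <grad f u - grad f x, c - x> for all c in C, and for
   u = z_lambda the right-hand side is lambda times its value at u = y, which is
   nonnegative and, for c <> x, positive by strict convexity.  What remains is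
   grad f (grad f^* w) = w.  By coercivity f - <w,.> attains its minimum at some
   p, so w is a subgradient of f at p.  Such a p is interior, since otherwise the
   gradients of f along a segment from p into the interior would stay bounded,
   contradicting essential smoothness; hence grad f p = w.  By strict convexity
   the minimum is unique and f - <w,.> grows at least linearly away from p, which
   gives 0 <= f^*(w + h e_i) - f^*(w) - h p_i <= |h| eps for small h, so that
   grad f^* w = p. *)
Require Import Defs.
From HB Require Import structures.
From mathcomp Require Import all_boot all_order all_algebra.
From mathcomp Require Import all_classical all_reals all_analysis.
From mathcomp Require Import ring lra.

Import Order.TTheory GRing.Theory Num.Theory.
Import numFieldNormedType.Exports.

Local Open Scope classical_set_scope.
Local Open Scope ring_scope.

(** * The Euclidean inner product, and the Euclidean norm compared with the sup norm *)

Section EuclideanFacts.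
Context {R : realType} {J : nat}.
Implicit Types u v w x : 'rV[R]_J.

Lemma dotC u v : dot u v = dot v u.
Proof. by apply: eq_bigr => i _; rewrite mulrC. Qed.

Lemma dotDr w u v : dot w (u + v) = dot w u + dot w v.
Proof. by rewrite -big_split; apply: eq_bigr => i _; rewrite mxE mulrDr. Qed.

Lemma dotZr w (a : R) u : dot w (a *: u) = a * dot w u.
Proof. by rewrite /dot big_distrr; apply: eq_bigr => i _ /=; rewrite mxE mulrCA. Qed.

Lemma dotNr w u : dot w (- u) = - dot w u.
Proof. by rewrite -scaleN1r dotZr mulN1r. Qed.

Lemma dotBr w u v : dot w (u - v) = dot w u - dot w v.
Proof. by rewrite dotDr dotNr. Qed.

Lemma dotDl u v w : dot (u + v) w = dot u w + dot v w.
Proof. by rewrite dotC dotDr !(dotC w). Qed.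

Lemma dotZl (a : R) u w : dot (a *: u) w = a * dot u w.
Proof. by rewrite dotC dotZr (dotC w). Qed.

Lemma dotBl u v w : dot (u - v) w = dot u w - dot v w.
Proof. by rewrite dotC dotBr !(dotC w). Qed.

Lemma dot_delta u i : dot u (delta_mx 0 i) = u 0 i.
Proof.
rewrite /dot (bigD1 i) //= big1 ?addr0 ?mxE ?eqxx ?mulr1 // => j ji.
by rewrite mxE (negbTE ji) andbF mulr0.
Qed.

Lemma continuous_dot w : continuous (dot w : 'rV[R]_J -> R).
Proof.
rewrite /dot; apply: continuous_big => [|i _ x]; first exact: add_continuous.
by apply: (@continuousM _ _ (fun=> w 0 i) (fun v : 'rV[R]_J => v 0 i));
  [exact: cst_continuous|exact: coord_continuous].
Qed.

Lemma coord_le_norm x i : `|x 0 i| <= `|x|.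
Proof.
by rewrite [leRHS]/Num.Def.normr /= mx_normrE; apply/bigmax_geP; right => /=; exists (0, i).
Qed.

Lemma norm_le_coord x (M : R) : 0 <= M -> (forall i, `|x 0 i| <= M) -> `|x| <= M.
Proof.
move=> M0 xM; rewrite [leLHS]/Num.Def.normr /= mx_normrE; apply/bigmax_leP; split => //=.
by move=> [k i] _ /=; rewrite (ord1 k).
Qed.

Lemma coord_le_enorm x i : `|x 0 i| <= enorm x.
Proof.
rewrite -sqrtr_sqr ler_wsqrtr // /dot (bigD1 i) //= expr2 lerDl.
by apply: sumr_ge0 => j _; rewrite -expr2 sqr_ge0.
Qed.

Lemma norm_le_enorm x : `|x| <= enorm x.
Proof. by apply: norm_le_coord => [|i]; [exact: sqrtr_ge0|exact: coord_le_enorm]. Qed.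

Lemma enorm_le_coord x (M : R) :
  (forall i, `|x 0 i| <= M) -> enorm x <= Num.sqrt (J%:R * M ^+ 2).
Proof.
move=> xM; apply: ler_wsqrtr.
rewrite mulr_natl -[X in _ *+ X]card_ord -sumr_const; apply: ler_sum => i _.
have := xM i; rewrite -expr2 -real_normK ?num_real // => xiM.
by rewrite lerXn2r ?nnegrE // (le_trans _ xiM).
Qed.

(** The l1 norm of [w] serves as the constant here: the coercivity argument needs only some constant
    depending on [w], not the sharp Cauchy-Schwarz one. *)
Lemma dot_le_enorm w x : `|dot w x| <= (\sum_i `|w 0 i|) * enorm x.
Proof.
rewrite mulr_suml; apply: le_trans (ler_norm_sum _ _ _) _.
by apply: ler_sum => i _; rewrite normrM ler_wpM2l // coord_le_enorm.
Qed.

Lemma compact_normle (r : R) : compact [set x : 'rV[R]_J | `|x| <= r].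
Proof.
apply: bounded_closed_compact.
  by exists r; split; [exact: num_real|move=> M rM x /= xr; rewrite (le_trans xr) // ltW].
refine (@preimage_closed _ _ (fun x : 'rV[R]_J => `|x|) [set y | y <= r] _ _).
  by move=> x _; exact: norm_continuous.
exact: closed_le.
Qed.

Lemma compact_sphere u (r : R) : compact [set x | `|x - u| = r].
Proof.
apply: bounded_closed_compact.
  exists (r + `|u|); split; [exact: num_real|move=> M rM x /= xr].
  by rewrite (le_trans _ (ltW rM)) // -{1}(subrK u x) (le_trans (ler_normD _ _)) // xr.
refine (@preimage_closed _ _ (fun x : 'rV[R]_J => `|x - u|) [set y | y = r] _ _).
  move=> x _; apply: (@continuous_comp _ _ _ (fun x => x - u) Num.Def.normr).
    exact: (cvgB cvg_id (cvg_cst _)).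
  exact: norm_continuous.
exact: closed_eq.
Qed.

End EuclideanFacts.

(** * Lower semicontinuous functions on compact sets *)

Lemma lsc_compact_gt {T : topologicalType} {R : realType} (h : T -> \bar R)
    (K : set T) (m : \bar R) :
  lower_semicontinuous h -> compact K -> (m < +oo)%E ->
  (forall x, K x -> (m < h x)%E) ->
  exists a : R, (m < a%:E)%E /\ forall x, K x -> (a%:E < h x)%E.
Proof.
move=> hlsc /compact_near_coveringP Kc mlt mh.
(* [G] is the filter of reals tending to [m] from above: right neighbourhoods of a finite [m],
   neighbourhoods of -oo otherwise. Compactness as near-covering then merges the pointwise gaps into
   one [a] valid on all of [K]. *)
have [G [PG Gm Glt]] : exists G : set_system R, [/\ ProperFilter G,
    (\forall a \near G, (m < a%:E)%E) &
    (forall b : R, (m < b%:E)%E -> \forall a \near G, a <= b)].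
  case: m mlt mh => [r _ _| //| _ _].
  - exists (r^'+); split; first exact: at_right_proper_filter.
      by apply: filterS (nbhs_right_gt r) => a; rewrite lte_fin.
    by move=> b; rewrite lte_fin => rb; exact: nbhs_right_le.
  - exists (ninfty_nbhs R); split; first exact: proper_ninfty_nbhs.
      by apply: nearW => a; rewrite ltNyr.
    by move=> b _; apply: nbhs_ninfty_le; exact: num_real.
have near_h : \forall a \near G, K `<=` [set x | (a%:E < h x)%E].
  apply: Kc => x Kx.
  have [b mb bh] : exists2 b : R, (m < b%:E)%E & (b%:E < h x)%E.
    have := mh x Kx; case: (h x) => [s| |]; case: (m) mlt => [r| |] //= _ rs.
    - exists ((r + s) / 2); rewrite lte_fin in rs *; rewrite ?lte_fin; lra.
    - by exists (s - 1); rewrite ?ltNyr ?lte_fin ?gtrBl.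
    - by exists (r + 1); rewrite ?ltry ?lte_fin ?ltrDl.
    - by exists 0; rewrite ?ltNyr ?ltry.
  have [V Vx Vh] := hlsc x b bh.
  exists (V, [set a | a <= b]); first by split => //; exact: Glt.
  move=> [y a] /= [Vy ab]; apply: le_lt_trans (Vh y Vy).
  by rewrite lee_fin.
have [a [ma Ka]] := @filter_ex _ G _ _ (filterI Gm near_h).
by exists a.
Qed.

(** If the infimum were not attained, it would lie strictly below every value on [K], and the
    uniform gap of [lsc_compact_gt] would give a larger lower bound. *)
Lemma lsc_compact_min {T : topologicalType} {R : realType} (h : T -> \bar R)
    (K : set T) :
  lower_semicontinuous h -> compact K -> K !=set0 ->
  exists2 p, K p & forall x, K x -> (h p <= h x)%E.
Proof.
move=> hlsc Kc [u Ku]; apply: contrapT => nomin.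
have infh x : K x -> (ereal_inf (h @` K) <= h x)%E.
  by move=> Kx; apply: ereal_inf_lbound; exists x.
have inflt x : K x -> (ereal_inf (h @` K) < h x)%E.
  move=> Kx; rewrite lt_neqAle infh // andbT; apply/eqP => e.
  by apply: nomin; exists x => // y Ky; rewrite -e infh.
have infy : (ereal_inf (h @` K) < +oo)%E.
  by apply: lt_le_trans (inflt u Ku) _; rewrite leey.
have [a [infa ah]] := lsc_compact_gt _ _ _ hlsc Kc infy inflt.
have : (a%:E <= ereal_inf (h @` K))%E.
  by apply: le_ereal_inf_tmp => _ [x Kx <-]; exact/ltW/ah.
by rewrite leNgt infa.
Qed.

Lemma lsc_sub_dot {R : realType} {J : nat} (f : 'rV[R]_J -> \bar R) (w : 'rV[R]_J) :
  lower_semicontinuous f ->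
  lower_semicontinuous (fun x => f x - (dot w x)%:E)%E.
Proof.
move=> flsc x a; rewrite lteBrDr // -EFinD => afx.
(* The level [b] splits the gap: near [x], [f] stays above [b] while the linear term stays below
   [b - a]. *)
have [b ab bf] : exists2 b : R, a + dot w x < b & (b%:E < f x)%E.
  case: (f x) afx => [s| |] //=.
    by rewrite lte_fin => as_; exists ((a + dot w x + s) / 2); rewrite ?lte_fin; lra.
  by move=> _; exists (a + dot w x + 1); rewrite ?ltry //; lra.
have [V Vx Vf] := flsc x b bf.
have Wx : \forall y \near x, dot w y < b - a.
  by refine (@cvgr_lt _ _ _ (nbhs_filter x) _ _ (continuous_dot w x) _ _); lra.
exists (V `&` [set y | dot w y < b - a]); first exact: filterI.
move=> y [Vy wy]; rewrite lteBrDr // -EFinD.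
apply: le_lt_trans (Vf y Vy); rewrite lee_fin; move: wy => /= wy; lra.
Qed.

(** * Subgradients, gradients and interior points of the domain for convex functions *)

Section ConvexFunctionFacts.
Context {R : realType} {J : nat} (f : 'rV[R]_J -> \bar R).
Implicit Types (p u v w x y : 'rV[R]_J) (t : R).

Lemma grad_dot x v : differentiable (fine \o f : 'rV[R]_J -> R) x ->
  dot (grad f x) v = 'D_v (fine \o f : 'rV[R]_J -> R) x.
Proof.
move=> df; rewrite deriveE // [in RHS](row_sum_delta v) linear_sum.
by apply: eq_bigr => i _; rewrite linearZ /= mxE deriveE // mulrC.
Qed.

Lemma grad_cvg_right x v : differentiable (fine \o f : 'rV[R]_J -> R) x ->
  h^-1 * (fine (f (h *: v + x)) - fine (f x)) @[h --> 0^'+] --> dot (grad f x) v.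
Proof.
move=> df; rewrite grad_dot //; apply: cvg_dnbhs_at_right.
by have dv : derivable (fine \o f : 'rV[R]_J -> R) x v by [exact: diff_derivable]; exact: dv.
Qed.

Context (f_proper : Defs.proper f).

Lemma dom_fineK x : dom f x -> (fine (f x))%:E = f x.
Proof.
move=> fx; apply: fineK; rewrite fin_numE (lt_eqF fx) andbT.
by rewrite eq_sym (lt_eqF (f_proper.1 x)).
Qed.

Lemma intdom_dom x : intdom f x -> dom f x.
Proof. exact: interior_subset. Qed.

(** If [f p] were +oo, the subgradient inequality would force [f] to be +oo everywhere, against
    properness. *)
Lemma subdiff_dom p w : subdiff f p w -> dom f p.
Proof.
move=> pw; have [y fy] := f_proper.2; move: (pw y) (fy) (f_proper.1 p).
rewrite /dom /=; case: (f p) => [r| |] //=.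
by rewrite addye //; case: (f y).
Qed.

Lemma subdiff_fine p w x : subdiff f p w -> dom f x ->
  fine (f p) + dot w (x - p) <= fine (f x).
Proof.
move=> pw fx; have := pw x.
by rewrite -(dom_fineK _ (subdiff_dom _ _ pw)) -(dom_fineK _ fx) -EFinD lee_fin.
Qed.

Lemma subdiffP p w : dom f p ->
  (forall x, dom f x -> fine (f p) + dot w (x - p) <= fine (f x)) -> subdiff f p w.
Proof.
move=> fp pw x; have [fx|] := ltP (f x) +oo%E; last by rewrite leye_eq => /eqP->; rewrite leey.
by rewrite -(dom_fineK _ fp) -(dom_fineK _ fx) -EFinD lee_fin pw.
Qed.

(** Dividing the subgradient inequality at [h *: v + p] by [h > 0] bounds [dot w v] by the
    directional derivative; the directions [v] and [- v] together give equality. *)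
Lemma subdiff_intdom_grad p w : subdiff f p w -> intdom f p ->
  differentiable (fine \o f : 'rV[R]_J -> R) p -> grad f p = w.
Proof.
move=> pw pU df.
have dirge v : dot w v <= dot (grad f p) v.
  apply: (cvgr_to_ge (grad_cvg_right p v df)).
  have nearU : \forall h \near (0 : R), dom f (h *: v + p).
    have : h *: v + p @[h --> (0 : R)] --> 0 *: v + p.
      by apply: cvgD; [apply: cvgZr_tmp; exact: cvg_id|exact: cvg_cst].
    by rewrite scale0r add0r => /(_ _ pU).
  near=> h.
  have h0 : 0 < h by near: h; exact: nbhs_right_gt.
  have hU : dom f (h *: v + p) by near: h; exact: cvg_within nearU.
  rewrite mulrC ler_pdivlMr // lerBrDl mulrC.
  by have := subdiff_fine _ _ _ pw hU; rewrite addrK dotZr.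
apply/rowP => i; rewrite -!dot_delta; apply/le_anti/andP; split => //.
by rewrite -lerN2 -!dotNr.
Unshelve. all: by end_near. Qed.

Context (f_convex : convex_efun f).

Lemma convex_fine x y t : dom f x -> dom f y -> 0 < t < 1 ->
  dom f (t *: x + (1 - t) *: y) /\
  fine (f (t *: x + (1 - t) *: y)) <= t * fine (f x) + (1 - t) * fine (f y).
Proof.
move=> fx fy t01; have := f_convex x y t t01.
rewrite -(dom_fineK x) // -(dom_fineK y) // -!EFinM -EFinD => le_t.
have fz : dom f (t *: x + (1 - t) *: y) by exact: le_lt_trans le_t (ltry _).
by split => //; rewrite -lee_fin (dom_fineK _ fz).
Qed.

(** By convexity the difference quotients from [x] towards [y] are at most [f y - f x], and the
    bound passes to the limit. *)
Lemma grad_subdiff x : intdom f x ->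
  differentiable (fine \o f : 'rV[R]_J -> R) x -> subdiff f x (grad f x).
Proof.
move=> xU df; apply: subdiffP => [|y fy]; first exact: intdom_dom.
rewrite -lerBrDl; apply: (cvgr_to_le (grad_cvg_right x (y - x) df)).
near=> h.
have h01 : 0 < h < 1 by apply/andP; split; near: h; [exact: nbhs_right_gt|exact: nbhs_right_lt].
have [h0 _] := andP h01.
have [_] := convex_fine y x h fy (intdom_dom _ xU) h01.
have -> : h *: y + (1 - h) *: x = h *: (y - x) + x.
  by rewrite scalerBr scalerBl scale1r [in RHS]addrAC -addrA (addrC x).
by move=> le_h; rewrite mulrC ler_pdivrMr //; lra.
Unshelve. all: by end_near. Qed.

(** The homothety with centre [p] and ratio [t] maps a neighbourhood of [u] inside [dom f] onto a
    neighbourhood of [pt], which lies in [dom f] by convexity. *)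
Lemma intdom_segment p u t : dom f p -> intdom f u -> 0 < t <= 1 ->
  intdom f (p + t *: (u - p)).
Proof.
move=> fp uU /andP[t0 t1].
have tn0 : t != 0 by rewrite gt_eqF.
set pt := p + _.
have : u + t^-1 *: (x - pt) @[x --> pt] --> u + t^-1 *: (pt - pt).
  exact: (cvgD (cvg_cst _) (cvgZl_tmp (cvgB cvg_id (cvg_cst _)))).
rewrite subrr scaler0 addr0 => /(_ _ uU) near_pt.
refine (@filterS _ _ (nbhs_filter pt) _ _ _ near_pt) => x /= fx.
set q := u + _ in fx.
have xE : x = t *: q + (1 - t) *: p.
  rewrite /q /pt scalerDr scalerA divff // scale1r scalerBr scalerBl scale1r.
  by apply/rowP => i; rewrite !mxE; ring.
have [t1'|] := ltP t 1; first by rewrite xE; apply: (convex_fine _ _ _ _ _ _).1 => //; rewrite t0.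
move=> t1'; have {}t1 : t = 1 by apply/le_anti/andP.
by rewrite xE t1 subrr scale0r addr0 scale1r.
Qed.

End ConvexFunctionFacts.

(** * Existence, interiority and strictness of subgradients for Legendre functions *)

Section LegendreFacts.
Context {R : realType} {J : nat} (f : 'rV[R]_J -> \bar R).
Implicit Types (p q u v w x y : 'rV[R]_J) (t : R).

Lemma coercive_subdiff w : Defs.proper f -> lower_semicontinuous f -> one_coercive f ->
  exists p, subdiff f p w.
Proof.
move=> f_proper f_lsc f_coercive; have [u fu] := f_proper.2.
(* Slope [W + 1] beats the linear term by one: far out, [f x - dot w x] is at least [enorm x].
   Outside the ball of radius [rho] this exceeds the value at [u], so the minimum over the ball is
   global. *)
pose W := \sum_i `|w 0 i|; have [r rP] := f_coercive (W + 1).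
pose rho := Num.max r (Num.max (enorm u) (fine (f u) - dot w u)).
have [rrho urho hrho] : [/\ r <= rho, enorm u <= rho & fine (f u) - dot w u <= rho].
  by rewrite /rho !le_max !lexx !orbT.
have [p Kp pmin] : exists2 p : 'rV[R]_J, `|p| <= rho &
    forall x, `|x| <= rho -> (f p - (dot w p)%:E <= f x - (dot w x)%:E)%E.
  apply: (lsc_compact_min _ _ (lsc_sub_dot f w f_lsc) (compact_normle rho)).
  by exists u => /=; rewrite (le_trans (norm_le_enorm u)).
have up : `|u| <= rho by rewrite (le_trans (norm_le_enorm u)).
have fp : dom f p.
  have := pmin u up; rewrite -(dom_fineK f f_proper u) // /dom /=.
  by case: (f p) => [s| |] //= _; rewrite ltry.
have minK x : `|x| <= rho -> dom f x -> fine (f p) - dot w p <= fine (f x) - dot w x.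
  move=> Kx fx; have := pmin x Kx.
  by rewrite -(dom_fineK f f_proper p) // -(dom_fineK f f_proper x) // -!EFinB lee_fin.
exists p; apply: subdiffP => // x fx; rewrite dotBr.
have [/minK /(_ fx)|rhox] := leP `|x| rho; first lra.
have {}rhox : rho < enorm x := lt_le_trans rhox (norm_le_enorm x).
have x0 : 0 < enorm x by rewrite (le_lt_trans _ rhox) // (le_trans _ urho) // sqrtr_ge0.
have := rP x (le_lt_trans rrho rhox).
rewrite lee_pdivlMr // -(dom_fineK f f_proper x) // -EFinM lee_fin => fxW.
have := dot_le_enorm w x; rewrite ler_norml -/W => /andP[_ wxW].
have := minK u up fu; lra.
Qed.

Context (f_legendre : legendre f).

Let f_proper : Defs.proper f. Proof. by case: f_legendre. Qed.
Let f_convex : convex_efun f. Proof. by case: f_legendre. Qed.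

Lemma legendre_differentiable x : intdom f x ->
  differentiable (fine \o f : 'rV[R]_J -> R) x.
Proof. by case: f_legendre => _ _ _ [_ + _] _; apply. Qed.

Lemma legendre_grad_subdiff x : intdom f x -> subdiff f x (grad f x).
Proof. by move=> xU; apply: grad_subdiff => //; exact: legendre_differentiable. Qed.

(* The bound does not depend on [t], so gradients stay bounded as the segment
   from an interior point [u] approaches [p]. *)
Lemma grad_segment_le p u q w t : subdiff f p w -> intdom f u -> dom f q ->
  0 < t <= 1 ->
  dot (grad f (p + t *: (u - p))) (q - u) <= fine (f q) - fine (f p) - dot w (u - p).
Proof.
move=> pw uU fq t01; have fp := subdiff_dom _ f_proper _ _ pw.
have [t0 t1] := andP t01.
set pt := p + _; set g := grad f pt.
have ptU : intdom f pt by exact: intdom_segment.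
have ptg : subdiff f pt g := legendre_grad_subdiff _ ptU.
have := subdiff_fine _ f_proper _ _ _ ptg fq.
have := subdiff_fine _ f_proper _ _ _ ptg fp.
have := subdiff_fine _ f_proper _ _ _ pw (intdom_dom _ _ ptU).
have -> : pt - p = t *: (u - p) by rewrite /pt addrC addKr.
have -> : p - pt = - (t *: (u - p)) by rewrite /pt opprD addrA subrr add0r.
have -> : q - pt = (q - u) + (1 - t) *: (u - p).
  by rewrite /pt; apply/rowP => i; rewrite !mxE; ring.
rewrite dotNr dotDr !dotZr => le1 le2 le3.
(* This is monotonicity of subgradients between [p] and [pt]; it lets [w] replace the unknown [g] in
   the direction [u - p]. *)
have ab : dot w (u - p) <= dot g (u - p) by rewrite -(ler_pM2l t0); lra.
have : (1 - t) * dot w (u - p) <= (1 - t) * dot g (u - p).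
  by apply: ler_wpM2l => //; lra.
lra.
Qed.

Lemma legendre_subdiff_intdom p w : subdiff f p w -> intdom f p.
Proof.
move=> pw; apply: contrapT => pNU; have fp := subdiff_dom _ f_proper _ _ pw.
have [[u uU] _ blowup] : essentially_smooth f by case: f_legendre.
have [e e0 eU] : exists2 e : R, 0 < e & forall i (s : R), `|s| <= e ->
    dom f (u + s *: delta_mx 0 i).
  have /nbhs_normP[e /= e0 eU] := uU.
  exists (e / 2); first lra.
  move=> i s se; apply: eU => /=; rewrite opprD addrA subrr add0r normrN.
  apply: (@le_lt_trans _ _ (e / 2)); last lra.
  apply: norm_le_coord => [|j]; first lra.
  rewrite !mxE eqxx /=; case: (j == i); rewrite ?mulr1 ?mulr0 ?normr0 //; lra.
(* The shift to [n.+1] keeps the segment parameter in ]0, 1], so every [x_ n] is interior. *)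
pose x_ (n : nat) := p + n.+1%:R^-1 *: (u - p).
have t01 n : 0 < (n.+1%:R^-1 : R) <= 1.
  by rewrite invr_gt0 ltr0n /= invf_le1 ?ltr0n // ler1n.
have x_U n : intdom f (x_ n) by exact: intdom_segment.
have x_p : x_ n @[n --> \oo] --> p.
  rewrite -[X in _ --> X]addr0 -(scale0r (u - p)).
  exact: (cvgD (cvg_cst p) (cvgZr_tmp cvg_harmonic)).
have pbd : (closure (intdom f) `\` (intdom f)°) p.
  split; last by rewrite (interior_id _).1 //; exact: open_interior.
  move=> B Bp; have /filter_ex[n Bn] : \forall n \near \oo, B (x_ n) by exact: x_p.
  by exists (x_ n).
pose b := fine (f p) + dot w (u - p).
(* Testing [grad_segment_le] with [q] equal to [u] plus or minus [e] times a basis vector bounds one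
   coordinate of the gradient from each side. Summing over all directions makes [M] independent of
   [i] and [n]. *)
pose M := \sum_i (`|fine (f (u + e *: delta_mx 0 i)) - b| +
  `|fine (f (u + (- e) *: delta_mx 0 i)) - b|).
have gM n i : `|grad f (x_ n) 0 i| <= M / e.
  have leM : `|fine (f (u + e *: delta_mx 0 i)) - b| +
    `|fine (f (u + (- e) *: delta_mx 0 i)) - b| <= M.
    by rewrite /M (bigD1 i) //= lerDl sumr_ge0.
  have dir s : `|s| <= e -> s * grad f (x_ n) 0 i <= fine (f (u + s *: delta_mx 0 i)) - b.
    move=> /(eU i) fq; have := grad_segment_le _ _ _ _ _ pw uU fq (t01 n).
    rewrite -dot_delta -dotZr addrAC subrr add0r /b /x_; lra.
  have ee : `|e| <= e by rewrite gtr0_norm.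
  have eNe : `|- e| <= e by rewrite normrN gtr0_norm.
  have := dir _ ee; have := dir _ eNe.
  have := ler_norm (fine (f (u + e *: delta_mx 0 i)) - b).
  have := ler_norm (fine (f (u + (- e) *: delta_mx 0 i)) - b).
  have := normr_ge0 (fine (f (u + e *: delta_mx 0 i)) - b).
  have := normr_ge0 (fine (f (u + (- e) *: delta_mx 0 i)) - b).
  move=> *; rewrite ler_pdivlMr // -[X in _ * X](gtr0_norm e0) -normrM ler_norml.
  by apply/andP; split; lra.
have /cvgryPge/(_ (Num.sqrt (J%:R * (M / e) ^+ 2) + 1)) := blowup x_ p x_U pbd x_p.
move=> /filter_ex[n]; have := enorm_le_coord _ _ (gM n); lra.
Qed.

Lemma legendre_subdiff_grad p w : subdiff f p w -> grad f p = w.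
Proof.
move=> pw; have pU := legendre_subdiff_intdom _ _ pw.
by apply: subdiff_intdom_grad => //; exact: legendre_differentiable.
Qed.

(** Essential strict convexity speaks of convex subsets of [dom_subdiff f]; this allows it to be
    applied to the interior. *)
Lemma convex_intdom : @convex_set R 'rV[R]_J (intdom f).
Proof.
move=> x y t; rewrite !inE => xU yU.
have [->|tn0] := eqVneq t 0%:i01; first by rewrite conv0.
change (intdom f (t%:num *: (x : 'rV[R]_J) + (1 - t%:num) *: (y : 'rV[R]_J))).
have -> : t%:num *: (x : 'rV[R]_J) + (1 - t%:num) *: (y : 'rV[R]_J) =
    y + t%:num *: ((x : 'rV[R]_J) - (y : 'rV[R]_J)).
  by apply/rowP => i; rewrite !mxE; ring.
apply: intdom_segment => //; first exact: intdom_dom.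
by rewrite le1 andbT lt_neqAle eq_sym tn0 ge0.
Qed.

(** Equality would make [w] a subgradient at [x] as well, so both points would be interior, and
    strict convexity at their midpoint would put [f] below its affine minorant. *)
Lemma legendre_subdiff_lt p w x : subdiff f p w -> dom f x -> x != p ->
  fine (f p) + dot w (x - p) < fine (f x).
Proof.
move=> pw fx xp; rewrite lt_neqAle subdiff_fine // andbT; apply/eqP => e.
have fp := subdiff_dom _ f_proper _ _ pw.
have xw : subdiff f x w.
  apply: subdiffP => // y fy; have := subdiff_fine _ f_proper _ _ _ pw fy.
  rewrite -e !dotBr; lra.
have f_strict : strictly_convex_on f (intdom f).
  case: f_legendre => _ _ _ _; apply; first exact: convex_intdom.
  by move=> y yU; exists (grad f y); exact: legendre_grad_subdiff.
have t01 : 0 < (2^-1 : R) < 1 by lra.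
have [fz _] := convex_fine f f_proper f_convex x p 2^-1 fx fp t01.
have := f_strict x p 2^-1 (legendre_subdiff_intdom _ _ xw)
  (legendre_subdiff_intdom _ _ pw) xp t01.
rewrite -(dom_fineK f f_proper _ fz) -(dom_fineK f f_proper x) //.
rewrite -(dom_fineK f f_proper p) // -!EFinM -EFinD lte_fin -e.
have := subdiff_fine _ f_proper _ _ _ pw fz.
rewrite !dotBr dotDr !dotZr; lra.
Qed.

End LegendreFacts.

(** * The gradient of the Fenchel conjugate *)

Section Conjugate.
Context {R : realType} {J : nat} (f : 'rV[R]_J -> \bar R).
Context (f_legendre : legendre f).
Implicit Types (p w x : 'rV[R]_J).

Let f_proper : Defs.proper f. Proof. by case: f_legendre. Qed.
Let f_convex : convex_efun f. Proof. by case: f_legendre. Qed.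

(** This is the equality case of the Fenchel-Young inequality. *)
Lemma fenchel_conj_subdiff p w : subdiff f p w ->
  fenchel_conj f w = (dot w p - fine (f p))%:E.
Proof.
move=> pw; have fp := subdiff_dom _ f_proper _ _ pw.
apply/le_anti/andP; split.
  apply: ge_ereal_sup => _ [x _ <-].
  have [fx|] := ltP (f x) +oo%E; last by rewrite leye_eq => /eqP->; rewrite leNye.
  rewrite -(dom_fineK f f_proper x) // -EFinB lee_fin.
  have := subdiff_fine _ f_proper _ _ _ pw fx; rewrite dotBr; lra.
apply: ereal_sup_ubound; exists p => //.
by rewrite -(dom_fineK f f_proper p) // -EFinB.
Qed.

(* A positive gap on the sphere of radius [e] propagates linearly outside of it
   by convexity. *)
Lemma legendre_subdiff_growth p w (e : R) : subdiff f p w -> 0 < e ->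
  exists2 d : R, 0 < d & forall x, dom f x -> e <= `|x - p| ->
    fine (f p) + dot w (x - p) + d * `|x - p| <= fine (f x).
Proof.
move=> pw e0; have fp := subdiff_dom _ f_proper _ _ pw.
have f_lsc : lower_semicontinuous f by case: f_legendre.
pose m := fine (f p) - dot w p.
have [a [ma ah]] : exists a : R, (m%:E < a%:E)%E /\ forall x, `|x - p| = e ->
    (a%:E < f x - (dot w x)%:E)%E.
  apply: (lsc_compact_gt _ _ _ (lsc_sub_dot f w f_lsc) (compact_sphere p e)).
    exact: ltry.
  move=> x /= xe; have [fx|] := ltP (f x) +oo%E; last first.
    by rewrite leye_eq => /eqP->; rewrite /= ltry.
  have xp : x != p by rewrite -subr_eq0 -normr_gt0 xe.
  rewrite -(dom_fineK f f_proper x) // -EFinB lte_fin /m.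
  have := legendre_subdiff_lt f f_legendre _ _ _ pw fx xp; rewrite dotBr; lra.
rewrite lte_fin in ma.
exists ((a - m) / e) => [|x fx ex]; first by rewrite divr_gt0 // subr_gt0.
have x0 : 0 < `|x - p| by exact: lt_le_trans ex.
(* [z] is the point where the segment from [p] to [x] crosses the sphere of radius [e]; the gap
   there, divided by [t], bounds the gap at [x]. *)
pose t := e / `|x - p|; pose z := t *: x + (1 - t) *: p.
have t0 : 0 < t by rewrite divr_gt0.
have t1 : t <= 1 by rewrite ler_pdivrMr // mul1r.
have zp : z - p = t *: (x - p) by apply/rowP => i; rewrite /z !mxE; ring.
have ze : `|z - p| = e by rewrite zp normrZ gtr0_norm // divfK // gt_eqF.
have [fz fzle] : dom f z /\ fine (f z) <= t * fine (f x) + (1 - t) * fine (f p).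
  have [t1'|t1'] := ltP t 1; first by apply: convex_fine; rewrite // t0.
  have -> : z = x by rewrite /z (_ : t = 1) ?subrr ?scale0r ?addr0 ?scale1r //; lra.
  by split => //; rewrite (_ : t = 1); lra.
have := ah z ze; rewrite -(dom_fineK f f_proper z) // -EFinB lte_fin => az.
have wz : dot w z = dot w p + t * dot w (x - p).
  by rewrite -dotZr -zp -dotDr addrC subrK.
rewrite -(ler_pM2l t0) mulrDr.
have -> : t * ((a - m) / e * `|x - p|) = a - m.
  by rewrite /t; field; rewrite !gt_eqF.
move: az; rewrite wz /m; lra.
Qed.

Lemma grad_fenchel_conj p w : subdiff f p w -> grad (fenchel_conj f) w = p.
Proof.
move=> pw; have fp := subdiff_dom _ f_proper _ _ pw.
apply/rowP => i; rewrite mxE; apply: cvg_lim => //.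
apply/cvgrPdist_le => e e0.
(* The tolerance [e] is also the radius. Within [e] of [p] the perturbation by [h] adds at most
   [|h| e] to the supremum; farther away the growth of slope [d] absorbs it as soon as
   [|h| <= d]. *)
have [d d0 growth] := legendre_subdiff_growth _ _ _ pw e0.
near=> h.
have hd : `|h| <= d by near: h; exact: dnbhs0_le.
have h0 : h != 0 by near: h; exact: nbhs_dnbhs_neq.
(* [b] is the value at [p] of the function whose supremum defines the conjugate at [w'], hence the
   lower bound [lo]. *)
pose w' := h *: delta_mx 0 i + w; pose b := dot w p - fine (f p) + h * p 0 i.
have w'E x : dot w' x = h * x 0 i + dot w x.
  by rewrite dotDl dotZl dotC dot_delta.
have lo : (b%:E <= fenchel_conj f w')%E.
  apply: le_trans (ereal_sup_ubound _); last by exists p.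
  rewrite -(dom_fineK f f_proper p) // -EFinB lee_fin w'E /b; lra.
have hi : (fenchel_conj f w' <= (b + `|h| * e)%:E)%E.
  apply: ge_ereal_sup => _ [x _ <-].
  have [fx|] := ltP (f x) +oo%E; last by rewrite leye_eq => /eqP->; rewrite leNye.
  rewrite -(dom_fineK f f_proper x) // -EFinB lee_fin w'E /b.
  have hx : h * (x - p) 0 i <= `|h| * `|x - p|.
    apply: le_trans (ler_norm _) _; rewrite normrM ler_wpM2l //.
    exact: coord_le_norm.
  have he : 0 <= `|h| * e by rewrite mulr_ge0 // ltW.
  move: hx; rewrite !mxE; have [ex|xe] := leP e `|x - p|.
    have : `|h| * `|x - p| <= d * `|x - p| by rewrite ler_wpM2r.
    have := growth x fx ex; rewrite dotBr; lra.
  have : `|h| * `|x - p| <= `|h| * e by rewrite ler_wpM2l // ltW.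
  have := subdiff_fine _ f_proper _ _ _ pw fx; rewrite dotBr; lra.
(* The two bounds make the conjugate finite at [w'], so [fine] in the difference quotient returns
   its true value. *)
have [r rE] : exists r : R, fenchel_conj f w' = r%:E.
  by case: (fenchel_conj f w') lo hi => [r| |] //; exists r.
rewrite /= -/w' rE (fenchel_conj_subdiff _ _ pw) /=.
rewrite rE !lee_fin in lo hi.
have -> : p 0 i - h^-1 *: (r - (dot w p - fine (f p))) = - (h^-1 * (r - b)).
  by rewrite /b /GRing.scale /=; field.
rewrite normrN normrM normfV ler_pdivrMl ?normr_gt0 // ger0_norm; lra.
Unshelve. all: by end_near. Qed.

End Conjugate.

(** * Characterization of farthest points and their persistence along the ray *)

Theorem proposition3p1 (R : realType) (J : nat) (f : 'rV[R]_J -> \bar R)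
    (C : set 'rV[R]_J)
    (f_legendre : legendre f) (f_coercive : one_coercive f)
    (C_neq0 : C !=set0) (C_bounded : ebounded C) (C_closed : closed C)
    (C_sub : C `<=` intdom f)
    (y x : 'rV[R]_J) (lambda : R)
    (yU : intdom f y) (xC : C x) (lambda_ge1 : 1 <= lambda) :
  (farthest f C y x <->
     (forall c, C c ->
        (bregman f c x <= (dot (grad f y - grad f x) (c - x))%:E)%E)) /\
  (farthest f C y x ->
     let z := grad (fenchel_conj f)
                (lambda *: grad f y + (1 - lambda) *: grad f x) in
     farthest f C z x /\ (1 < lambda -> farthest f C z = [set x])).
Proof.
have f_proper : Defs.proper f by case: f_legendre.
have Cdom c : C c -> dom f c by move=> /C_sub /intdom_dom.
have bregmanE u c : intdom f u -> C c ->
    bregman f c u = (fine (f c) - fine (f u) - dot (grad f u) (c - u))%:E.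
  move=> uU /Cdom fc; rewrite /bregman mem_set //.
  by rewrite -(dom_fineK f f_proper c) // -(dom_fineK f f_proper u) //; exact: intdom_dom.
have xU := C_sub _ xC.
(* Stated for every interior [u], since it is applied both at [y] and at [p], the point [z] of the
   statement. *)
have char u : intdom f u -> farthest f C u x <-> (forall c, C c ->
    (bregman f c x <= (dot (grad f u - grad f x) (c - x))%:E)%E).
  move=> uU; split=> [[_ _ max] c Cc|le_dot].
    have := max c Cc; rewrite !bregmanE // !lee_fin dotBl !dotBr; lra.
  split => // c Cc; have := le_dot c Cc.
  rewrite !bregmanE // !lee_fin dotBl !dotBr; lra.
split=> [|xfar]; first exact: char.
have lf : lower_semicontinuous f by case: f_legendre.
set w := lambda *: grad f y + (1 - lambda) *: grad f x.
have [p pw] := coercive_subdiff f w f_proper lf f_coercive.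
rewrite /= (grad_fenchel_conj f f_legendre _ _ pw).
have pU := legendre_subdiff_intdom f f_legendre _ _ pw.
have gp : grad f p - grad f x = lambda *: (grad f y - grad f x).
  rewrite (legendre_subdiff_grad f f_legendre _ _ pw) /w.
  by apply/rowP => i; rewrite !mxE; ring.
have xsub := legendre_grad_subdiff f f_legendre _ xU.
have le_y c : C c -> fine (f c) - fine (f x) - dot (grad f x) (c - x) <=
    dot (grad f y - grad f x) (c - x).
  by move=> Cc; have := (char y yU).1 xfar c Cc; rewrite bregmanE // lee_fin.
have ge0 c : C c -> 0 <= dot (grad f y - grad f x) (c - x).
  move=> Cc; apply: le_trans (le_y c Cc).
  have := subdiff_fine _ f_proper _ _ _ xsub (Cdom c Cc); lra.
have xfarp : farthest f C p x.
  apply/(char p pU) => c Cc; rewrite bregmanE // lee_fin gp dotZl.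
  by apply: le_trans (le_y c Cc) _; rewrite ler_peMl // ge0.
split=> // lambda_gt1; apply/seteqP; split=> [c [_ Cc max]|_ -> //].
apply: contrapT => /eqP cx.
(* For a second maximizer [c], the Bregman distance from [c] to [x] is positive, at most [D] by
   [le_y], and at least [lambda * D] by maximality of [c]. This is impossible for [lambda > 1]. *)
have := legendre_subdiff_lt f f_legendre _ _ _ xsub (Cdom c Cc) cx.
have := max x xC; rewrite !bregmanE // lee_fin.
have : dot (grad f p - grad f x) (c - x) = lambda * dot (grad f y - grad f x) (c - x).
  by rewrite gp dotZl.
have := le_y c Cc.
set D := dot (grad f y - grad f x) (c - x).
rewrite dotBl !dotBr => le1 eq1 le2 lt1.
have D0 : 0 < D by lra.
have : D < lambda * D by rewrite ltr_pMl.
lra.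
Qed.
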